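(* Let $G$ be a countably infinite amenable group with left Følner sequences $\mathbf{G},\mathbf{F}_1,\dots,\mathbf{F}_k$, where $\mathbf{G}$ is left tempered. Let $S_1,\dots,S_k\subseteq G$ be such that $\overline{d}_{\mathbf{F}_i}(S_i)>0$ for each $i=1,\dots,k$. Then there is $S\subseteq G$ such that $d_{\mathbf{G}}(S)\ge\prod_{i=1}^k\overline{d}_{\mathbf{F}_i}(S_i)$ and $\Delta_1(S)\subseteq D:=\bigcap_{i=1}^k\Delta_2(\mathbf{F}_i,S_i)$. Furthermore, there are $m_1,\dots,m_\ell\in G$, where $$\ell\le\prod_{i=1}^k 1/\overline{d}_{\mathbf{F}_i}(S_i),$$ such that $\bigcup_{i=1}^\ell m_iD=\bigcup_{i=1}^\ell Dm_i^{-1}=G$.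
   Context: A left Følner sequence in a countably infinite group $G$ is a sequence $(F_N)_{N=1}^\infty$ of finite non-empty subsets of $G$ with $\lim_{N\to\infty}|F_N\cap gF_N|/|F_N|=1$ for all $g\in G$. A sequence $(F_n)_{n=1}^\infty$ of finite subsets of a group $G$ is (left) tempered if there is a constant $C>0$ such that $\left|\bigcup_{k<n}F_k^{-1}F_n\right|\le C|F_n|$ for all $n>1$, where $A^{-1}B=\{a^{-1}b:a\in A,b\in B\}$. For a Følner sequence $\mathbf{F}=(F_N)_{N=1}^\infty$ and $S\subseteq G$, $\overline{d}_{\mathbf{F}}(S)=\limsup_{N\to\infty}|S\cap F_N|/|F_N|$ and $\underline{d}_{\mathbf{F}}(S)=\liminf_{N\to\infty}|S\cap F_N|/|F_N|$; if they are equal the common value is denoted $d_{\mathbf{F}}(S)$. An assertion about $d_{\mathbf{F}}(S)$ includes the assertion that it exists. For $g\in G$, $g^{-1}S=\{h\in G:gh\in S\}$. Define $\Delta_1(S)=\{g\in G:S\cap g^{-1}S\neq\emptyset\}$ and $\Delta_2(\mathbf{F},S)=\{g\in G:\overline{d}_{\mathbf{F}}(S\cap g^{-1}S)>0\}$. *)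

(* Defs.v *)
From HB Require Import structures.
From mathcomp Require Import all_boot all_order all_algebra.
From mathcomp Require Import finmap.
From mathcomp Require Import all_classical all_reals all_analysis.
Import Order.TTheory GRing.Theory Num.Theory.
Import numFieldNormedType.Exports.

Set Implicit Arguments.
Unset Strict Implicit.
Unset Printing Implicit Defensive.

Local Open Scope classical_set_scope.
Local Open Scope ring_scope.

(* Sequences of finite sets are indexed from 0: [F n] is the (n+1)-st term
   of the usual sequence F_1, F_2, ... *)

Definition left_translate (G : groupType) (g : G) (A : {fset G}) : {fset G} :=
  [fset (g * x)%g | x in A]%fset.

(* A^-1 B *)
Definition inv_mul_fset (G : groupType) (A B : {fset G}) : {fset G} :=
  [fset (a^-1 * b)%g | a in A, b in B]%fset.

Definition left_folner (R : realType) (G : groupType) (F : nat -> {fset G}) :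
    Prop :=
  (forall n, F n != fset0%fset) /\
  forall g : G,
    (fun n => #|` (F n `&` left_translate g (F n))%fset|%:R / #|` F n|%:R : R)
      @ \oo --> (1 : R).

(* With 0-based indices the condition "n > 1" becomes "n > 0". *)
Definition left_tempered (R : realType) (G : groupType) (F : nat -> {fset G}) :
    Prop :=
  exists C : R, 0 < C /\
  forall n, (0 < n)%N ->
    #|` \big[@fsetU G/fset0%fset]_(j < n) inv_mul_fset (F j) (F n)|%:R
      <= C * #|` F n|%:R.

(* Amenability of a countable group. *)
Definition amenable (R : realType) (G : groupType) : Prop :=
  exists F : nat -> {fset G}, left_folner R F.

Definition rel_freq (R : realType) (G : groupType) (F : nat -> {fset G})
    (S : set G) (n : nat) : R :=
  #|` [fset x in F n | x \in S]%fset|%:R / #|` F n|%:R.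

Definition upper_density (R : realType) (G : groupType) (F : nat -> {fset G})
    (S : set G) : R :=
  limn_sup (rel_freq R F S).

Definition lower_density (R : realType) (G : groupType) (F : nat -> {fset G})
    (S : set G) : R :=
  limn_inf (rel_freq R F S).

Definition has_density (R : realType) (G : groupType) (F : nat -> {fset G})
    (S : set G) (d : R) : Prop :=
  lower_density R F S = d /\ upper_density R F S = d.

(* g^-1 S *)
Definition inv_translate (G : groupType) (g : G) (S : set G) : set G :=
  [set h | S (g * h)%g].

Definition Delta1 (G : groupType) (S : set G) : set G :=
  [set g | (S `&` inv_translate g S) !=set0].

Definition Delta2 (R : realType) (G : groupType) (F : nat -> {fset G})
    (S : set G) : set G :=
  [set g | 0 < upper_density R F (S `&` inv_translate g S)].

(* Main.v *)
Require Import Defs.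
From HB Require Import structures.
From mathcomp Require Import all_boot all_order all_algebra.
From mathcomp Require Import finmap.
From mathcomp Require Import all_classical all_reals all_analysis.
From mathcomp Require Import ring lra.
Import Order.TTheory GRing.Theory Num.Theory.
Import numFieldNormedType.Exports.

Local Open Scope classical_set_scope.
Local Open Scope ring_scope.

(** Call S a clique when x y^-1 belongs to D for all x, y in S; this says
exactly that Delta1 S is contained in D.  Being a clique passes to subsets, to
right translates S x^-1 and to limits of sets, and these three stabilities
reduce the theorem to finite counting.

Cliques of large density inside finite sets.  Fix a finite set A and average,
over h in a far term of the Folner sequence F_i, the size of the set of those
x in A for which x h lies in S_i.  Left invariance makes the average at least
upper density of S_i times |A|, up to an error tending to 0.  If x h and y h
are both in S_i, then h lies in a left translate of a set whose upper density
is positive only if y x^-1 belongs to Delta2; discarding a null set of h, the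
sets being averaged are cliques for Delta2 of S_i ([Delta2_clique_dense]).
Applying this successively for each i, inside the set just obtained, gives in
every finite A a clique with at least delta |A| elements, delta being the
product of the upper densities ([bigcap_Delta2_clique_dense]).

Syndeticity.  Let M be a largest finite set in which no two distinct a, b have
both a b^-1 and b a^-1 in D.  A clique in M has at most one element, so
delta |M| <= 1, and maximality says that every g is related to a member of M
([clique_dense_syndetic]).

Existence of an actual density.  Let d >= delta be the largest number such
that every finite set K contains a clique of relative size d, or nearly so
([extremal_density]).  By double counting, every clique has relative density
at most d + o(1) in the terms of any Folner sequence ([count_clique_le]), so
only a lower bound is needed.  Since all averages are at most d + eps, the
deficiency phi(x) = d + eps - avg_N(x), avg_N(x) being the relative density of
S x^-1 in F_N, is nonnegative, and its mean over a huge window is O(eps) when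
S nearly attains d there.  The weak-type maximal inequality for tempered
sequences ([tempered_maximal_inequality]) then shows that, for all but a small
proportion of the points x of the window, no later average of phi exceeds a
given lambda, whence avg_M(x) >= d - 2 lambda for all later M.  Doing this for
a sequence of lambda's tending to 0 with summable exceptional proportions
gives translates S x^-1 whose densities converge to d at a prescribed rate up
to any prescribed time, and an ultrafilter limit of these is the required set
([clique_of_exact_density]). *)

(** * Sums over finite sets *)

Section FiniteSums.
Context {R : realType}.

Lemma sum_const_fset {T : choiceType} (A : {fset T}) (c : R) :
  \sum_(x <- A) c = c * #|` A|%:R.
Proof. by rewrite big_const_seq count_predT iter_addr_0 mulr_natr. Qed.

Lemma in_fset_sep {T : choiceType} (A : {fset T}) (P : pred T) x :
  (x \in [fset y in A | P y]%fset) = (x \in A) && P x.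
Proof. by rewrite !inE. Qed.

Lemma card_sum_fset {T : choiceType} (A : {fset T}) (P : pred T) :
  #|` [fset x in A | P x]%fset|%:R = \sum_(x <- A) ((P x)%:R : R).
Proof.
rewrite -[LHS]mul1r -sum_const_fset big_fset /= [RHS](eq_bigr (fun x => if P x then 1 else 0)).
  by rewrite -big_mkcond.
by move=> x _; case: (P x).
Qed.

Lemma ler_sum_inj {T U : choiceType} (E : {fset T}) (K : {fset U}) (f : T -> U)
    (phi : U -> R) :
  injective f -> (forall y, 0 <= phi y) -> (forall y, y \notin K -> phi y = 0) ->
  \sum_(x <- E) phi (f x) <= \sum_(y <- K) phi y.
Proof.
move=> finj phi0 phiK.
have -> : \sum_(x <- E) phi (f x) = \sum_(y <- [fset f x | x in E]%fset) phi y.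
  by rewrite big_imfset //= => x y _ _ /finj.
rewrite (big_fsetID _ (mem K)) /= [X in _ + X]big_seq [X in _ + X]big1 ?addr0; last first.
  by move=> y; rewrite !inE => /andP[_ /phiK].
rewrite [leRHS](big_fsetID _ (mem [fset f x | x in E]%fset)) /=.
rewrite (_ : [fset _ | _ in _ & _]%fset = [fset x | x in K & x \in [fset f x0 | x0 in E]]%fset);
  last by apply/fsetP => y; rewrite !inE andbC.
by rewrite lerDl sumr_ge0.
Qed.
End FiniteSums.

(** * The maximal inequality for tempered sequences *)

Section MaximalInequality.
Context {R : realType} {G : groupType}.

(** Membership of y in the union of the translates H x, x ranging over X. *)
Let covers (H : {fset G}) (X : seq G) (y : G) :=
  has (fun x => (y * x^-1)%g \in H) X.

(** One level of the covering argument.  A translate H x is kept only if at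
least half of its phi-mass is new, so the translates kept, although they may
overlap, have total size controlled by the mass of their union; a translate
that is not kept already has half of its mass in that union.  Weighing the
overlaps by phi instead of by cardinality is what makes a deterministic
selection sufficient. *)
Lemma greedy_cover (H K : {fset G}) (phi : G -> R) (lambda : R) (s : seq G) :
  (forall y, 0 <= phi y) -> (forall y, y \notin K -> phi y = 0) ->
  (forall x, x \in s -> lambda * #|` H|%:R <= \sum_(g <- H) phi (g * x)%g) ->
  exists X : seq G,
    lambda * #|` H|%:R * (size X)%:R <= 2 * \sum_(y <- K | covers H X y) phi y /\
    forall x, x \in s ->
      lambda * #|` H|%:R <= 2 * \sum_(g <- H | covers H X (g * x)%g) phi (g * x)%g.
Proof.
move=> phi0 phiK; elim: s => [|x s IHs] heavy.
  exists [::]; split=> //=; rewrite mulr0 mulr_ge0 // sumr_ge0 //.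
have [|X [massX sX]] := IHs.
  by move=> y ys; apply: heavy; rewrite inE ys orbT.
have heavyx := heavy x (mem_head _ _).
case: (leP (lambda * #|` H|%:R)
   (2 * \sum_(g <- H | covers H X (g * x)%g) phi (g * x)%g)) => [old|new].
  by exists X; split=> // y; rewrite inE => /orP[/eqP->//|/sX].
exists (x :: X); split; last first.
  move=> y ys.
  have mono : \sum_(g <- H | covers H X (g * y)%g) phi (g * y)%g <=
              \sum_(g <- H | covers H (x :: X) (g * y)%g) phi (g * y)%g.
    rewrite big_mkcond [leRHS]big_mkcond /=; apply: ler_sum => g _.
    by case: (covers H X _); rewrite ?orbT//; case: ifP.
  move: ys; rewrite inE => /orP[/eqP yx|/sX]; last lra.
  have -> : \sum_(g <- H | covers H (x :: X) (g * y)%g) phi (g * y)%g =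
            \sum_(g <- H) phi (g * y)%g.
    rewrite big_seq_cond [RHS]big_seq; apply: eq_bigl => g.
    by case gH: (g \in H) => //=; rewrite yx mulgK gH.
  have : 0 <= \sum_(g <- H) phi (g * x)%g by rewrite sumr_ge0.
  by rewrite yx; lra.
have split_heavy : \sum_(g <- H) phi (g * x)%g =
    \sum_(g <- H | covers H X (g * x)%g) phi (g * x)%g +
    \sum_(g <- H | ~~ covers H X (g * x)%g) phi (g * x)%g.
  by rewrite (bigID (fun g => covers H X (g * x)%g)).
pose psi y := if ((y * x^-1)%g \in H) && ~~ covers H X y then phi y else 0.
have new_mass : \sum_(g <- H | ~~ covers H X (g * x)%g) phi (g * x)%g <=
                \sum_(y <- K) psi y.
  have -> : \sum_(g <- H | ~~ covers H X (g * x)%g) phi (g * x)%g =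
            \sum_(g <- H) psi (g * x)%g.
    rewrite big_mkcond big_seq [RHS]big_seq; apply: eq_bigr => g gH.
    by rewrite /psi mulgK gH.
  apply: (ler_sum_inj _ _ (fun g => (g * x)%g)).
  - exact: mulIg.
  - by move=> y; rewrite /psi; case: ifP.
  - by move=> y /phiK yK; rewrite /psi yK if_same.
have total : \sum_(y <- K | covers H (x :: X) y) phi y =
    \sum_(y <- K | covers H X y) phi y + \sum_(y <- K) psi y.
  rewrite big_mkcond [X in _ = X + _]big_mkcond -big_split /=.
  apply: eq_bigr => y _; rewrite /psi /=.
  by case: (covers H X y); rewrite ?orbT ?andbF ?orbF ?andbT ?addr0 ?add0r.
by rewrite total /= -natr1 mulrDr mulr1; lra.
Qed.

(** The weak-type (1,1) estimate behind the pointwise ergodic theorem.  Levels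
are treated downwards from the largest index, [greedy_cover] being applied to the
translates of the current level; temperedness bounds the number of centres of
lower translates that are lost because they meet the part already covered, and
the rest is handled by induction with phi set to 0 there. *)
Lemma tempered_maximal_inequality (F : nat -> {fset G}) (C : R) (K : {fset G})
    (lambda : R) (T : nat) :
  (forall n, F n != fset0%fset) -> 0 < C ->
  (forall n, (0 < n)%N ->
    #|` \big[@fsetU G/fset0%fset]_(j < n) inv_mul_fset (F j) (F n)|%:R
      <= C * #|` F n|%:R) ->
  0 < lambda ->
  forall (phi : G -> R) (E : {fset G}),
  (forall y, 0 <= phi y) -> (forall y, y \notin K -> phi y = 0) ->
  (forall x, x \in E -> exists2 j, (j < T)%N &
    lambda * #|` F j|%:R <= \sum_(g <- F j) phi (g * x)%g) ->
  lambda * #|` E|%:R <= 2 * (1 + C) * \sum_(y <- K) phi y.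
Proof.
move=> F0 C0 tempF lambda0; elim: T => [|T IHT] phi E phi0 phiK heavy.
  have -> : E = fset0.
    by apply/eqP; rewrite -[_ == _]negbK; apply/negP => /fset0Pn[x /heavy[]].
  by rewrite cardfs0 mulr0 !mulr_ge0 ?sumr_ge0//; lra.
set H := F T.
have H0 : 0 < #|` H|%:R :> R by rewrite ltr0n cardfs_gt0 F0.
pose ET := [fset x in E | lambda * #|` H|%:R <= \sum_(g <- H) phi (g * x)%g]%fset.
have [|X [massX coverX]] := greedy_cover H K phi lambda ET phi0 phiK.
  by move=> x; rewrite !inE => /andP[].
pose U := covers H X.
pose massU := \sum_(y <- K | U y) phi y.
pose phi' y := if U y then 0 else phi y.
have mass_split : \sum_(y <- K) phi y = massU + \sum_(y <- K) phi' y.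
  rewrite (bigID U) /=; congr (_ + _); rewrite big_mkcond.
  by apply: eq_bigr => y _; rewrite /phi'; case: (U y).
(* Each point of K belongs to g E_T for a given g in H through one centre only,
   so the second half of greedy_cover, summed over E_T, bounds its size. *)
have card_top : lambda * #|` ET|%:R <= 2 * massU.
  rewrite -(ler_pM2r H0).
  have -> : lambda * #|` ET|%:R * #|` H|%:R = \sum_(x <- ET) (lambda * #|` H|%:R).
    by rewrite sum_const_fset mulrAC.
  pose phiU y := if U y then phi y else 0.
  have phiU0 y : 0 <= phiU y by rewrite /phiU; case: ifP.
  have phiUK y : y \notin K -> phiU y = 0.
    by move=> /phiK yK; rewrite /phiU yK if_same.
  apply: (@le_trans _ _ (\sum_(x <- ET) 2 * \sum_(g <- H) phiU (g * x)%g)).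
    rewrite big_seq [leRHS]big_seq; apply: ler_sum => x /coverX.
    by rewrite big_mkcond.
  rewrite -mulr_sumr exchange_big /= -mulrA ler_pM2l // mulrC.
  apply: (@le_trans _ _ (\sum_(g <- H) massU)).
    apply: ler_sum => g _; rewrite /massU [leRHS]big_mkcond /=.
    by apply: ler_sum_inj => //; exact: mulgI.
  by rewrite sum_const_fset mulrC.
(* A lower translate F_j x meeting U has its centre in F_j^-1 F_T X: this is
   where temperedness enters. *)
pose W := (\big[@fsetU G/fset0%fset]_(j < T) inv_mul_fset (F j) (F T))%fset.
have cardW : #|` W|%:R <= C * #|` H|%:R.
  case: (posnP T) => [T0|/tempF//].
  rewrite /W; move: T0 => /[dup] T0 ->; rewrite big_ord0 cardfs0.
  by rewrite mulr_ge0 // ltW.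
pose E3 := [fset x in E | has (fun y => (x * y^-1)%g \in W) X]%fset.
have card_E3 : #|` E3|%:R <= #|` W|%:R * (size X)%:R :> R.
  rewrite -natrM ler_nat -(size_allpairs (fun w y => (w * y)%g)).
  apply: uniq_leq_size; first exact: fset_uniq.
  move=> x; rewrite !inE => /andP[_ /hasP[y yX xyW]].
  apply/allpairsP; exists ((x * y^-1)%g, y) => /=; split=> //.
  by rewrite mulgVK.
have card_meet : lambda * #|` E3|%:R <= 2 * C * massU.
  apply: (@le_trans _ _ (lambda * (C * #|` H|%:R * (size X)%:R))).
    rewrite ler_pM2l //; apply: (le_trans card_E3).
    by rewrite ler_wpM2r.
  have := massX; rewrite -/massU -(ler_pM2l C0); lra.
(* The remaining translates miss U, so they stay heavy for phi', and the masses
   of phi' and of phi on U add up to that of phi. *)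
pose E' := [fset x in E | (x \notin ET) && (x \notin E3)]%fset.
have card_E' : lambda * #|` E'|%:R <= 2 * (1 + C) * \sum_(y <- K) phi' y.
  apply: IHT => [y|y /phiK yK|x].
  - by rewrite /phi'; case: ifP.
  - by rewrite /phi' yK if_same.
  rewrite inE /= => /and3P[xE xET xE3].
  have [j] := heavy _ xE.
  rewrite ltnS leq_eqVlt => /orP[/eqP->|jT] heavyj.
    by move: xET; rewrite !inE xE /= heavyj.
  exists j => //; apply: (le_trans heavyj).
  rewrite big_seq [leRHS]big_seq; apply: ler_sum => g gF.
  rewrite /phi'; case: ifP => // /hasP[y yX gxyH].
  move: xE3; rewrite !inE xE /= => /hasP; case; exists y => //.
  apply/bigfcupP; exists (Ordinal jT); first by rewrite mem_index_enum.
  apply/imfset2P; exists g => //; exists (g * x * y^-1)%g => //.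
  by rewrite -mulgA mulKg.
have cover_E : (#|` E| <= #|` ET| + #|` E3| + #|` E'|)%N.
  apply: (@leq_trans #|` (ET `|` E3 `|` E')%fset|).
    apply/fsubset_leq_card/fsubsetP => x xE.
    rewrite in_fsetU in_fsetU; case xT: (x \in ET) => //=.
    by case x3: (x \in E3) => //=; rewrite in_fset_sep xE xT x3.
  by rewrite (leq_trans (leq_card_fsetU _ _).1)// leq_add2r (leq_card_fsetU _ _).1.
have : lambda * #|` E|%:R <= lambda * (#|` ET|%:R + #|` E3|%:R + #|` E'|%:R).
  by rewrite ler_pM2l // -!natrD ler_nat.
by rewrite mass_split; lra.
Qed.
End MaximalInequality.

(** * Almost invariance and double counting *)

Section Invariance.
Context {R : realType} {G : groupType}.

Definition almost_invariant (eps : R) (B A : {fset G}) : Prop :=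
  forall g, g \in B ->
    (1 - eps) * #|` A|%:R <= #|` (A `&` left_translate g A)%fset|%:R.

Lemma sum_almost_invariant (A B : {fset G}) (eps : R) (g : G) (phi : G -> R) :
  (forall y, 0 <= phi y <= 1) -> almost_invariant eps B A -> g \in B ->
  `|\sum_(x <- A) phi (g * x)%g - \sum_(x <- A) phi x| <= eps * #|` A|%:R.
Proof.
move=> phi01 invA /invA; set gA := left_translate g A => cap.
have -> : \sum_(x <- A) phi (g * x)%g = \sum_(y <- gA) phi y.
  by rewrite big_imfset //= => x y _ _ /mulgI.
have cardgA : #|` gA| = #|` A|.
  by rewrite card_imfset //=; exact: mulgI.
have bound (X Y : {fset G}) : #|` X| = #|` A| ->
    (1 - eps) * #|` A|%:R <= #|` (X `&` Y)%fset|%:R ->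
    0 <= \sum_(y <- [fset y in X | y \notin Y]%fset) phi y <= eps * #|` A|%:R.
  move=> cardX capX; rewrite sumr_ge0 /=; last by move=> y _; case/andP: (phi01 y).
  apply: (@le_trans _ _ (\sum_(y <- [fset y in X | y \notin Y]%fset) 1)).
    by apply: ler_sum => y _; case/andP: (phi01 y).
  rewrite sum_const_fset mul1r.
  have : (#|` X|)%:R = #|` (X `&` Y)%fset|%:R + #|` [fset y in X | y \notin Y]%fset|%:R :> R.
    rewrite -[LHS]mul1r -sum_const_fset (big_fsetID _ (mem Y)) /= !sum_const_fset !mul1r.
    by congr (#|` _|%:R + _); apply/fsetP => y; rewrite !inE.
  by rewrite cardX; lra.
rewrite (big_fsetID _ (mem A) gA) (big_fsetID _ (mem gA) A) /=.
rewrite (_ : [fset x in gA | x \in A]%fset = [fset x in A | x \in gA]%fset); last first.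
  by apply/fsetP => y; rewrite !in_fset_sep andbC.
have := bound gA A cardgA; rewrite fsetIC => /(_ cap).
have := bound A gA erefl cap.
by move=> /andP[? ?] /andP[? ?]; rewrite ler_norml; apply/andP; split; lra.
Qed.

(** Averaging phi over the translates B x of B, with x in an almost invariant
set A, gives the average of phi over A.  Every passage between a finite shape
B and a Folner set below is an instance of this exchange of sums. *)
Lemma double_sum_almost_invariant (A B : {fset G}) (eps : R) (phi : G -> R) :
  (forall y, 0 <= phi y <= 1) -> almost_invariant eps B A ->
  `|\sum_(x <- A) \sum_(g <- B) phi (g * x)%g - #|` B|%:R * \sum_(x <- A) phi x|
    <= eps * #|` A|%:R * #|` B|%:R.
Proof.
move=> phi01 invA; rewrite exchange_big /= mulrC -(sum_const_fset B (\sum_(x <- A) _)).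
rewrite -(sum_const_fset B (_ * _)) -sumrB.
apply: (le_trans (ler_norm_sum _ _ _)).
rewrite big_seq [leRHS]big_seq; apply: ler_sum => g gB.
exact: sum_almost_invariant invA gB.
Qed.

(** With phi the indicator of A, a point x whose translate B x sticks out of A
lowers the double sum of [double_sum_almost_invariant] by at least one. *)
Lemma card_exit_le (A B : {fset G}) (eps : R) :
  almost_invariant eps B A ->
  #|` [fset x in A | ~~ all (fun g => (g * x)%g \in A) B]%fset|%:R
    <= eps * #|` A|%:R * #|` B|%:R.
Proof.
move=> invA.
have ind01 (y : G) : 0 <= ((y \in A)%:R : R) <= 1.
  by case: (y \in A); rewrite ?ler01 ?lexx.
have := double_sum_almost_invariant A B eps (fun y => (y \in A)%:R) ind01 invA.
have -> : \sum_(x <- A) ((x \in A)%:R : R) = #|` A|%:R.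
  by rewrite -[RHS]mul1r -sum_const_fset big_seq [RHS]big_seq; apply: eq_bigr => x ->.
rewrite ler_norml => /andP[lo _].
suff : \sum_(x <- A) \sum_(g <- B) ((g * x)%g \in A)%:R
     + #|` [fset x in A | ~~ all (fun g => (g * x)%g \in A) B]%fset|%:R
    <= #|` B|%:R * #|` A|%:R :> R by lra.
rewrite card_sum_fset -big_split /= -sum_const_fset; apply: ler_sum => x _.
rewrite -[leRHS]mul1r -sum_const_fset.
have : \sum_(g <- B) ((g * x)%g \in A)%:R <= \sum_(g <- B) 1 :> R.
  by apply: ler_sum => g _; case: (_ \in A); rewrite ?ler01 ?lexx.
case: (boolP (all _ _)) => [_|/allPn[g gB gxA]] /=; first lra.
move=> _; rewrite !(big_fsetD1 g gB) /= (negbTE gxA) add0r addrC lerD2l.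
by apply: ler_sum => h _; case: (_ \in A); rewrite ?ler01 ?lexx.
Qed.

Lemma folner_almost_invariant (F : nat -> {fset G}) (B : {fset G}) (eps : R) :
  left_folner R F -> 0 < eps -> \forall n \near \oo, almost_invariant eps B (F n).
Proof.
move=> [F0 Finv] eps0.
suff : forall s : seq G, \forall n \near \oo, forall g, g \in s ->
    (1 - eps) * #|` F n|%:R <= #|` (F n `&` left_translate g (F n))%fset|%:R.
  by apply.
elim=> [|g s IHs]; first by near=> n.
have /cvgr_gt/(_ (1 - eps)) := Finv g; rewrite ltrBlDr ltrDl => /(_ eps0) invg.
near=> n => h; rewrite inE => /orP[/eqP->|hs].
- rewrite -ler_pdivlMr ?ltr0n ?cardfs_gt0 //.
  by apply/ltW; near: n.
- by move: h hs; near: n.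
Unshelve. all: by end_near. Qed.
End Invariance.

(** * Cliques and their extremal density *)

Section Cliques.
Context {R : realType} {G : groupType}.

Definition clique (D S : set G) : Prop :=
  forall x y, S x -> S y -> D (x * y^-1)%g.

Lemma clique_translate (D S : set G) (x : G) :
  clique D S -> clique D [set g | S (g * x)%g].
Proof.
move=> cS g h /= Sgx Shx; have := cS _ _ Sgx Shx.
by rewrite mulgKA.
Qed.

Definition count_in (A : {fset G}) (S : set G) : R := \sum_(x <- A) (x \in S)%:R.

Lemma count_in_translate (A : {fset G}) (S : set G) (x : G) :
  count_in A [set g | S (g * x)%g] = \sum_(g <- A) ((g * x)%g \in S)%:R.
Proof. by apply: eq_bigr => g _; congr (nat_of_bool _)%:R; apply/idP/idP; rewrite !inE. Qed.

Lemma ind01 (S : set G) (y : G) : 0 <= ((y \in S)%:R : R) <= 1.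
Proof. by case: (y \in S); rewrite ?ler01 ?lexx. Qed.

Lemma rel_freqE (F : nat -> {fset G}) (S : set G) (n : nat) :
  rel_freq R F S n = count_in (F n) S / #|` F n|%:R.
Proof. by rewrite /rel_freq card_sum_fset. Qed.

Lemma count_in_le_card (A : {fset G}) (S : set G) : count_in A S <= #|` A|%:R.
Proof.
rewrite -[leRHS]mul1r -sum_const_fset; apply: ler_sum => x _.
by case/andP: (ind01 S x).
Qed.

(** The extremal delta is what replaces ergodicity: bounding all cliques from
above by the value that some cliques nearly attain from below forces averages
to be almost constant. *)
Lemma extremal_density (D : set G) (d : R) :
  (forall K, exists2 S, clique D S & d * #|` K|%:R <= count_in K S) ->
  exists delta : R, [/\ d <= delta,
    forall eps, 0 < eps -> forall K, exists2 S, clique D S &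
      (delta - eps) * #|` K|%:R <= count_in K S &
    forall eps, 0 < eps -> exists K, forall S, clique D S ->
      count_in K S < (delta + eps) * #|` K|%:R].
Proof.
move=> Pd.
pose P : set R := [set d' | forall K, exists2 S, clique D S & d' * #|` K|%:R <= count_in K S].
have supP : has_sup P.
  split; first by exists d.
  exists 1 => d' /(_ [fset 1%g]%fset)[S _].
  have := count_in_le_card [fset 1%g]%fset S.
  by rewrite cardfs1; lra.
exists (sup P); split.
- by apply: sup_upper_bound.
- move=> eps eps0 K; have [d' Pd' lt] := sup_adherent eps0 supP.
  have [S cS dS] := Pd' K; exists S => //; apply: le_trans dS.
  by rewrite ler_wpM2r // ltW.
- move=> eps eps0; apply: contrapT => nK.
  have : P (sup P + eps).
    move=> K; apply: contrapT => nS; apply: nK; exists K => S cS.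
    by rewrite ltNge; apply/negP => le; apply: nS; exists S.
  by move=> /(sup_upper_bound supP); lra.
Qed.

(** The bound on a single shape K spreads to every almost K-invariant set,
because the right translates of a clique are cliques; uniformity in S is used
to bound all translates at once. *)
Lemma count_clique_le (D : set G) (F : nat -> {fset G}) (delta eps : R) :
  left_folner R F ->
  (forall eps : R, 0 < eps -> exists K, forall S, clique D S ->
      count_in K S < (delta + eps) * #|` K|%:R) ->
  0 < eps ->
  \forall n \near \oo, forall S, clique D S ->
    count_in (F n) S <= (delta + eps) * #|` F n|%:R.
Proof.
move=> folF up eps0; have eps20 : 0 < eps / 2 by lra.
have [K HK] := up _ eps20.
near=> n => S cS.
have invF : almost_invariant (eps / 2) K (F n).
  by near: n; apply: folner_almost_invariant.
have := double_sum_almost_invariant (F n) K (eps / 2) (fun y => (y \in S)%:R) (ind01 S) invF.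
rewrite ler_norml => /andP[lo _].
have : \sum_(x <- F n) \sum_(g <- K) ((g * x)%g \in S)%:R <=
   (delta + eps / 2) * #|` K|%:R * #|` F n|%:R.
  rewrite -sum_const_fset; apply: ler_sum => x _.
  by rewrite -count_in_translate; apply/ltW/HK; exact: clique_translate.
move=> up_sum.
have K0 : 0 < #|` K|%:R :> R.
  rewrite ltr0n lt0n; apply/negP => /eqP K0.
  by have := HK S cS; rewrite K0 mulr0 ltNge sumr_ge0.
rewrite -(ler_pM2l K0); move: lo up_sum; rewrite /count_in; lra.
Unshelve. all: by end_near. Qed.
End Cliques.

(** * Cliques with an exact density along a tempered sequence *)

Section PointwiseErgodic.
Context {R : realType} {G : groupType}.
Context (D : set G) (F : nat -> {fset G}) (delta : R).
Context (folF : left_folner R F) (tempF : left_tempered R F).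
Context (lower_delta : forall eps : R, 0 < eps -> forall K : {fset G},
  exists2 S, clique D S & (delta - eps) * #|` K|%:R <= count_in K S).
Context (upper_delta : forall eps : R, 0 < eps -> exists K : {fset G},
  forall S, clique D S -> count_in K S < (delta + eps) * #|` K|%:R).

Let F0 n : 0 < #|` F n|%:R :> R.
Proof. by rewrite ltr0n cardfs_gt0; case: folF. Qed.

(** The sum counts the right translate S x^-1 in F_M, so that moving the base
point x amounts to moving within the translates of the clique S. *)
Definition low_average (lambda : R) (S : set G) (x : G) (M : nat) : bool :=
  \sum_(g <- F M) ((g * x)%g \in S)%:R < (delta - lambda) * #|` F M|%:R.

(** The threshold M0 is chosen before the horizon T and does not depend on it,
which is the finitary content of almost everywhere convergence.  A low average
of the indicator at x forces a high average of the deficiency phi of the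
averages at a fixed time N, as averaging twice is harmless when F_M is almost
F_N-invariant; phi is nonnegative and of small mean, so the maximal inequality
applies. *)
Lemma few_low_averages (S : nat -> set G) (lambda eta : R) :
  (forall n, clique D (S n)) ->
  (forall theta : R, 0 < theta -> \forall n \near \oo,
     (delta - theta) * #|` F n|%:R <= count_in (F n) (S n)) ->
  0 < lambda -> 0 < eta ->
  exists M0, forall T, \forall n \near \oo,
    #|` [fset x in F n | has (fun M => (M0 <= M)%N && low_average lambda (S n) x M)
                             (iota 0 T)]%fset|%:R <= eta * #|` F n|%:R.
Proof.
move=> cS densS lambda0 eta0; have [C [C0 temp]] := tempF.
pose c := 2 * (1 + C); have c0 : 0 < c by rewrite /c; lra.
(* With this eps the maximal inequality loses eta / 4 to eps; theta below is
   such that its two contributions add up to eta / 2. *)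
pose eps := eta * lambda / (8 * c).
have eps0 : 0 < eps by rewrite divr_gt0 // mulr_gt0.
have [N _ upN] := count_clique_le D F delta eps folF upper_delta eps0.
have {}upN (S' : set G) : clique D S' -> count_in (F N) S' <= (delta + eps) * #|` F N|%:R.
  exact: (upN N (leqnn N)).
have lambda20 : 0 < lambda / 2 by lra.
have [M0 _ invM] := folner_almost_invariant F (F N) (lambda / 2) folF lambda20.
exists M0 => T.
pose B := (\big[@fsetU G/fset0%fset]_(M < T) F M)%fset.
pose theta := eta / (2 * (#|` B|%:R + 4 * c / lambda)).
have den0 : 0 < #|` B|%:R + 4 * c / lambda by rewrite ltr_wpDl ?ler0n // divr_gt0 // mulr_gt0.
have theta0 : 0 < theta by rewrite divr_gt0 // mulr_gt0.
near=> n.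
have dens : (delta - theta) * #|` F n|%:R <= count_in (F n) (S n).
  by near: n; exact: densS.
have invN : almost_invariant theta (F N) (F n).
  by near: n; exact: folner_almost_invariant.
have invB : almost_invariant theta B (F n).
  by near: n; exact: folner_almost_invariant.
move: dens invN invB; set K := F n; set Sn := S n => dens invN invB.
set bad := [fset x in K | _]%fset.
pose avg (y : G) : R := (\sum_(h <- F N) ((h * y)%g \in Sn)%:R) / #|` F N|%:R.
(* Cutting phi off outside the window K makes its total mass finite; the centres
   in E are those for which the cut-off is invisible. *)
pose phi (y : G) : R := if y \in K then delta + eps - avg y else 0.
have avg_le y : avg y <= delta + eps.
  rewrite /avg ler_pdivrMr // -count_in_translate.
  apply: upN.
  apply: clique_translate.
  exact: cS.
have phi0 y : 0 <= phi y.
  by rewrite /phi; case: ifP => // _; have := avg_le y; lra.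
have sum_phi : \sum_(y <- K) phi y <= (eps + 2 * theta) * #|` K|%:R.
  have -> : \sum_(y <- K) phi y = (delta + eps) * #|` K|%:R - \sum_(y <- K) avg y.
    rewrite -sum_const_fset -sumrB big_seq [RHS]big_seq; apply: eq_bigr => y yK.
    by rewrite /phi yK.
  suff : (delta - 2 * theta) * #|` K|%:R <= \sum_(y <- K) avg y by lra.
  rewrite -mulr_suml ler_pdivlMr //.
  have := double_sum_almost_invariant K (F N) theta (fun y => (y \in Sn)%:R) (ind01 Sn) invN.
  rewrite ler_norml => /andP[lo _].
  have := F0 N; move: dens; rewrite /count_in => dens FN.
  by move: dens; rewrite -(ler_pM2l FN); lra.
pose E := [fset x in bad | all (fun g => (g * x)%g \in K) B]%fset.
have cardE : lambda / 2 * #|` E|%:R <= c * \sum_(y <- K) phi y.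
  apply: (tempered_maximal_inequality F C K _ T folF.1 C0 temp lambda20 phi E phi0).
    by move=> y yK; rewrite /phi (negbTE yK).
  move=> x; rewrite in_fset_sep => /andP[]; rewrite in_fset_sep => /andP[xK].
  move=> /hasP[M]; rewrite mem_iota add0n => /andP[_ MT] /andP[M0M low] /allP xB.
  exists M => //.
  have inK g : g \in F M -> (g * x)%g \in K.
    move=> gM; apply: xB; apply/bigfcupP.
    by exists (Ordinal MT); rewrite ?mem_index_enum.
  have -> : \sum_(g <- F M) phi (g * x)%g =
    (delta + eps) * #|` F M|%:R - \sum_(g <- F M) avg (g * x)%g.
    rewrite -sum_const_fset -sumrB big_seq [RHS]big_seq; apply: eq_bigr => g gM.
    by rewrite /phi inK.
  suff : \sum_(g <- F M) avg (g * x)%g <= (delta - lambda / 2) * #|` F M|%:R.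
    by have := mulr_gt0 eps0 (F0 M); lra.
  rewrite -mulr_suml ler_pdivrMr //.
  have := double_sum_almost_invariant (F M) (F N) (lambda / 2)
     (fun y => ((y * x)%g \in Sn)%:R) (fun y => ind01 Sn (y * x)%g) (invM M M0M).
  under eq_bigr do under eq_bigr do rewrite -mulgA.
  rewrite ler_norml => /andP[_ hi].
  by move: low; rewrite /low_average -(ltr_pM2l (F0 N)); lra.
have cardbad : #|` bad|%:R <= #|` E|%:R + theta * #|` K|%:R * #|` B|%:R.
  apply: le_trans (lerD (lexx _) (card_exit_le K B theta invB)).
  rewrite -natrD ler_nat.
  apply: leq_trans (leq_card_fsetU _ _).1.
  apply/fsubset_leq_card/fsubsetP => x xbad.
  have xK : x \in K by move: xbad; rewrite in_fset_sep => /andP[].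
  rewrite in_fsetU [x \in E]in_fset_sep xbad in_fset_sep xK /=.
  by case: (all _ _).
apply: (le_trans cardbad).
have cardE' : #|` E|%:R <= (eta / 4 + 4 * c / lambda * theta) * #|` K|%:R.
  rewrite -(ler_pM2l lambda20); apply: (le_trans cardE).
  apply: (le_trans (ler_wpM2l (ltW c0) sum_phi)).
  rewrite le_eqVlt; apply/orP; left; apply/eqP.
  rewrite /eps; field; lra.
have : (#|` B|%:R + 4 * c / lambda) * theta = eta / 2.
  by rewrite /theta; move: den0; set X := _ + _ => X0; field; rewrite gt_eqF.
move=> /(congr1 (fun z => z * #|` K|%:R)).
have := mulr_gt0 eta0 (F0 n); rewrite -/K; lra.
Unshelve. all: by end_near. Qed.

(** The translate of S_n by a point x outside all exceptional sets satisfies the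
finitely many conditions with level j and time M below T.  Each condition only
involves a finite part of G, so it passes to the limit in T. *)
Lemma clique_of_exact_density :
  exists2 S, clique D S & rel_freq R F S @ \oo --> delta.
Proof.
have [S cS densS] : exists2 S : nat -> set G, (forall n, clique D (S n)) &
    forall theta : R, 0 < theta -> \forall n \near \oo,
     (delta - theta) * #|` F n|%:R <= count_in (F n) (S n).
  have Sn n : exists S, clique D S /\
      (delta - (n.+1%:R)^-1) * #|` F n|%:R <= count_in (F n) S.
    have n0 : 0 < (n.+1%:R)^-1 :> R by rewrite invr_gt0 ltr0n.
    by have [S] := lower_delta _ n0 (F n); exists S.
  have [S HS] := choice Sn; exists S => [n|theta theta0]; first by have [] := HS n.
  near=> n; have [_] := HS n; apply: le_trans.
  rewrite ler_wpM2r // lerD2l lerN2.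
  near: n; apply: filterS (near_infty_natSinv_lt (PosNum theta0)) => m.
  exact: ltW.
pose lam j : R := (2^-1) ^+ j.
have lam0 j : 0 < lam j by rewrite exprn_gt0.
(* The exceptional proportions lam j / 4 add up to less than 1, so that some
   point of the window avoids all the exceptional sets. *)
have sum_lam T : \sum_(j < T) lam j / 4 < 1.
  have -> : \sum_(j < T) lam j / 4 = (1 - lam T) / 2.
    elim: T => [|T IHT]; first by rewrite big_ord0 /lam expr0; lra.
    by rewrite big_ord_recr /= IHT /lam exprS; lra.
  by have := lam0 T; lra.
have level j : exists M0, forall T, \forall n \near \oo,
    #|` [fset x in F n | has (fun M => (M0 <= M)%N && low_average (lam j) (S n) x M)
                             (iota 0 T)]%fset|%:R <= lam j / 4 * #|` F n|%:R.
  by apply: few_low_averages => //; rewrite divr_gt0.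
have [M0 HM0] := choice level.
have good T : exists Sg : set G, clique D Sg /\
    forall j M, (j < T)%N -> (M0 j <= M < T)%N ->
      (delta - lam j) * #|` F M|%:R <= count_in (F M) Sg.
  pose bad j n := [fset x in F n | has (fun M => (M0 j <= M)%N &&
    low_average (lam j) (S n) x M) (iota 0 T)]%fset.
  have : \forall n \near \oo, forall j : 'I_T, #|` bad j n|%:R <= lam j / 4 * #|` F n|%:R.
    by apply: filter_forall => j; exact: HM0.
  case=> n _ /(_ n (leqnn n)) badn.
  have [x xF xgood] : exists2 x, x \in F n & forall j : 'I_T, x \notin bad j n.
    apply: contrapT => nox.
    have : (#|` F n|%:R : R) <= \sum_(j < T) #|` bad j n|%:R.
      rewrite -natr_sum ler_nat.
      apply: (@leq_trans #|` \big[@fsetU G/fset0%fset]_(j < T) bad j n|%fset).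
        apply/fsubset_leq_card/fsubsetP => x xF; apply/bigfcupP.
        apply: contrapT => nj; apply: nox; exists x => // j.
        by apply/negP => xj; apply: nj; exists j => //; rewrite mem_index_enum.
      elim/big_ind2: _ => [|A a B b Aa Bb|j _]; rewrite ?cardfs0 //.
      by rewrite (leq_trans (leq_card_fsetU _ _).1) // leq_add.
    move=> /le_trans/(_ (ler_sum _ (fun j _ => badn j))).
    by rewrite -mulr_suml -[leLHS]mul1r ler_pM2r // leNgt sum_lam.
  exists [set g | S n (g * x)%g]; split; first exact: clique_translate.
  move=> j M jT /andP[M0M MT].
  rewrite count_in_translate leNgt; apply/negP => low.
  have /negP := xgood (Ordinal jT); apply.
  rewrite in_fset_sep xF; apply/hasP; exists M; first by rewrite mem_iota.
  by rewrite M0M.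
have [Sg Hg] := choice good.
(* On each finite set the limit L agrees with Sg T for U-almost every T. *)
have [U [UU leU]] := @ultraFilterLemma nat \oo _.
pose L : set G := [set x | U [set T | Sg T x]].
have agree x : U [set T | (x \in Sg T) = (x \in L)].
  have [Ux|Ux] := in_ultra_setVsetC [set T | Sg T x] UU.
    have Lx : L x by [].
    by apply: filterS Ux => T /= SgT; rewrite (mem_set SgT) (mem_set Lx).
  have Lx : ~ L x.
    move=> Lx; have [T [? ?]] := filter_ex (filterI Lx Ux); contradiction.
  by apply: filterS Ux => T /= SgT; rewrite (memNset SgT) (memNset Lx).
have agreeF (s : seq G) : U [set T | forall x, x \in s -> (x \in Sg T) = (x \in L)].
  elim: s => [|x s IHs]; first by apply: filterS filterT.
  apply: filterS (filterI (agree x) IHs) => T [/= ax as_] y.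
  by rewrite inE => /orP[/eqP->|/as_].
have cL : clique D L.
  move=> x y Lx Ly.
  have [T [Tx Ty]] := filter_ex (filterI Lx Ly).
  exact: (Hg T).1.
exists L => //.
have upL e : 0 < e -> _ := count_clique_le D F delta e folF upper_delta.
apply/cvgrPdist_le => e e0.
have [j _ lamj] : \forall j \near \oo, lam j <= e.
  have /cvgr0_norm_le/(_ _ e0) : lam j @[j --> \oo] --> 0 by apply: cvg_expr; rewrite ger0_norm; lra.
  by apply: filterS => j; rewrite gtr0_norm.
have {lamj} := lamj j (leqnn j) => lamj.
near=> M.
suff [lo hi] : (delta - e) * #|` F M|%:R <= count_in (F M) L /\
               count_in (F M) L <= (delta + e) * #|` F M|%:R.
  move: lo hi; rewrite rel_freqE -ler_pdivlMr // => lo; rewrite -ler_pdivrMr // => hi.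
  by rewrite ler_norml; apply/andP; split; lra.
split; last by move: cL; apply: (near (upL _ e0)).
have big : U [set T | (maxn M j < T)%N] by apply: leU; exists (maxn M j).+1.
have [T [/= agr]] := filter_ex (filterI (agreeF (F M)) big).
rewrite gtn_max => /andP[MT jT].
have -> : count_in (F M) L = count_in (F M) (Sg T) :> R.
  by rewrite /count_in big_seq [RHS]big_seq; apply: eq_bigr => x /agr ->.
apply: le_trans ((Hg T).2 j M jT _); first by rewrite ler_wpM2r // lerB.
by rewrite MT andbT; near: M; exact: nbhs_infty_ge.
Unshelve. all: by end_near. Qed.
End PointwiseErgodic.

(** * Upper densities *)

Section UpperDensity.
Context {R : realType} {G : groupType}.
Context (F : nat -> {fset G}) (S : set G).

Lemma rel_freq01 n : 0 <= rel_freq R F S n <= 1.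
Proof.
rewrite rel_freqE divr_ge0 ?sumr_ge0 //=.
have := count_in_le_card (R := R) (F n) S.
have [->|Fn0] := eqVneq (F n) fset0; first by rewrite cardfs0 invr0 mulr0 ler01.
by rewrite ler_pdivrMr ?ltr0n ?cardfs_gt0 // mul1r.
Qed.

Lemma upper_densityE : upper_density R F S = inf (range (sups (rel_freq R F S))).
Proof.
apply: limn_supE; exists 1; split; first exact: num_real.
move=> M M1 n _ /=; have /andP[f0 f1] := rel_freq01 n.
by rewrite ger0_norm // (le_trans f1) // ltW.
Qed.

Let sdrop_sup n : has_sup (sdrop (rel_freq R F S) n).
Proof.
split; first by exists (rel_freq R F S n), n => //=.
by exists 1 => _ [m _ <-]; case/andP: (rel_freq01 m).
Qed.

Let sups_inf : has_inf (range (sups (rel_freq R F S))).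
Proof.
split; first by exists (sups (rel_freq R F S) 0), 0.
exists 0 => _ [n _ <-]; have /andP[f0 _] := rel_freq01 n.
by apply: le_trans f0 _; apply: sup_upper_bound => //; exists n => /=.
Qed.

Lemma upper_density_lt c N : c < upper_density R F S ->
  exists2 n, (N <= n)%N & c < rel_freq R F S n.
Proof.
rewrite upper_densityE => cd.
have : c < sups (rel_freq R F S) N.
  by apply: lt_le_trans cd _; apply: inf_lbound; [exact: sups_inf.2 | exists N].
move=> cs.
by have [_ [n Nn <-] lt] := sup_gt (sdrop_sup N).1 cs; exists n.
Qed.

Lemma upper_density_gt c : upper_density R F S < c ->
  \forall n \near \oo, rel_freq R F S n <= c.
Proof.
rewrite upper_densityE => dc.
have [_ [N _ <-] lt] := inf_lt sups_inf.1 dc.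
exists N => // n /= Nn; apply/ltW/(le_lt_trans _ lt).
by apply: sup_upper_bound => //; exists n.
Qed.
End UpperDensity.

(** * Large cliques inside finite sets *)

Section FiniteCliques.
Context {R : realType} {G : groupType}.

Lemma ex_max_fset (P : {fset G} -> Prop) (b : nat) :
  (exists B, P B) -> (forall B, P B -> (#|` B| <= b)%N) ->
  exists2 B, P B & forall B', P B' -> (#|` B'| <= #|` B|)%N.
Proof.
move=> [B0 PB0] bound.
have ex : exists m, `[<exists2 B, P B & #|` B| = m>].
  by exists #|` B0|; apply/asboolP; exists B0.
have ub m : `[<exists2 B, P B & #|` B| = m>] -> (m <= b)%N.
  by move=> /asboolP[B PB <-]; apply: bound.
case: (ex_maxnP ex ub) => m /asboolP[B PB Bm] max; exists B => // B' PB'.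
by rewrite Bm; apply: max; apply/asboolP; exists B'.
Qed.

(** A largest clique B in A already works: if |B| were smaller than the claimed
bound, then, for h outside a set of small proportion, the points x of A with
x h in S would form a clique, hence number at most |B|, whereas their average
number over h is almost the upper density of S times |A|. *)
Lemma Delta2_clique_dense (F : nat -> {fset G}) (S : set G) (A : {fset G}) :
  left_folner R F ->
  exists B : {fset G}, [/\ B `<=` A, clique (Delta2 R F S) [set` B] &
    upper_density R F S * #|` A|%:R <= #|` B|%:R]%fset.
Proof.
move=> folF; set D := Delta2 R F S; set d := upper_density R F S.
pose P (B : {fset G}) := (B `<=` A)%fset /\ clique D [set` B].
have [B [BA cB] maxB] : exists2 B, P B & forall B', P B' -> (#|` B'| <= #|` B|)%N.
  apply: (ex_max_fset P #|` A|) => [|B [BA _]]; last exact: fsubset_leq_card.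
  exists fset0; split=> [|x y]; first exact: fsub0set.
  by rewrite /= in_fset0.
exists B; split=> //; rewrite leNgt; apply/negP => ltB.
set a : R := #|` A|%:R in ltB; set m : R := #|` B|%:R in ltB maxB.
have m0 : 0 <= m by exact: ler0n.
have a0 : 0 < a.
  rewrite ltr0n lt0n; apply/negP => /eqP A0; move: ltB.
  by rewrite /a A0 mulr0; lra.
pose eps := (d * a - m) / (4 * a * (1 + a * a)).
have eps0 : 0 < eps.
  apply: divr_gt0; first lra.
  by rewrite mulr_gt0 ?addr_gt0 // mulr_gt0.
pose Q x y : set G := S `&` inv_translate (y * x^-1)%g S.
(* For z = (x, y), the condition h in Q x y, translated by x, says that x h and
   y h both lie in S; it is negligible when y x^-1 is not in Delta2. *)
have nullQ : \forall n \near \oo, forall z, z \in [seq (x, y) | x <- A, y <- A] ->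
    ~ D (z.2 * z.1^-1)%g -> rel_freq R F (Q z.1 z.2) n <= eps.
  elim: [seq _ | _ <- _, _ <- _] => [|z s IHs]; first by near=> n.
  have Hz : \forall n \near \oo, ~ D (z.2 * z.1^-1)%g -> rel_freq R F (Q z.1 z.2) n <= eps.
    have [Dz|/negP nDz] := pselect (D (z.2 * z.1^-1)%g); first by near=> n => /(_ Dz).
    have : upper_density R F (Q z.1 z.2) < eps by apply: le_lt_trans eps0; rewrite leNgt.
    by move=> /upper_density_gt; apply: filterS.
  by apply: filterS (filterI Hz IHs) => n [Hn1 Hn2] y; rewrite inE => /orP[/eqP->|/Hn2].
have [N _ HN] := filterI nullQ (folner_almost_invariant F A eps folF eps0).
have [n Nn freqn] : exists2 n, (N <= n)%N & d - eps < rel_freq R F S n.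
  by apply: upper_density_lt; rewrite -/d; lra.
have {HN}[{}nullQ invA] := HN n Nn.
have Fn0 : 0 < #|` F n|%:R :> R by rewrite ltr0n cardfs_gt0; case: folF.
pose q x y h : R := if `[<D (y * x^-1)%g>] then 0 else ((x * h)%g \in Q x y)%:R.
have sum_q x y : x \in A -> y \in A ->
    \sum_(h <- F n) q x y h <= 2 * eps * #|` F n|%:R.
  move=> xA yA; rewrite /q; case: asboolP => nD.
    by rewrite big1 //; have := mulr_gt0 eps0 Fn0; lra.
  have := sum_almost_invariant (F n) A eps x (fun z => (z \in Q x y)%:R)
    (ind01 (Q x y)) invA xA.
  rewrite ler_norml => /andP[_ hi].
  have := nullQ (x, y) (allpairs_f _ xA yA) nD.
  by rewrite rel_freqE ler_pdivrMr // /count_in /=; lra.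
have q0 x y h : 0 <= q x y h by rewrite /q; case: ifP.
(* Either the points of A sent into S by h form a clique, or some pair of them
   is forbidden and the double sum of q is at least 1. *)
have pointwise h : \sum_(x <- A) ((x * h)%g \in S)%:R <=
    m + a * \sum_(x <- A) \sum_(y <- A) q x y h.
  case: (pselect (exists x y, [/\ x \in A, y \in A, (x * h)%g \in S, (y * h)%g \in S
     & ~ D (y * x^-1)%g])) => [[x [y [xA yA xS yS nD]]]|good].
    have ge1 : 1 <= \sum_(x <- A) \sum_(y <- A) q x y h.
      rewrite (big_fsetD1 x xA) /= (big_fsetD1 y yA) /=.
      have -> : q x y h = 1.
        rewrite /q; case: asboolP => // _; rewrite mem_set //.
        split; first exact: set_mem.
        by rewrite /inv_translate /= mulgA mulgVK; exact: set_mem.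
      rewrite -addrA lerDl addr_ge0 ?sumr_ge0 // => *.
      by rewrite sumr_ge0.
    have le_a : \sum_(x <- A) ((x * h)%g \in S)%:R <= a.
      rewrite /a -[leRHS]mul1r -sum_const_fset; apply: ler_sum => z _.
      by case: (_ \in S); rewrite ?ler01 ?lexx.
    by move: ge1; rewrite -(ler_pM2l a0); lra.
  have PB' : P [fset x in A | (x * h)%g \in S]%fset.
    split; first by apply/fsubsetP => x; rewrite in_fset_sep => /andP[].
    move=> x y; rewrite /= !in_fset_sep => /andP[xA xS] /andP[yA yS].
    by apply: contrapT => nD; apply: good; exists y, x.
  have := maxB _ PB'; rewrite -(ler_nat R) card_sum_fset => /le_trans; apply.
  rewrite lerDl mulr_ge0 //.
  by apply: sumr_ge0 => x _; apply: sumr_ge0.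
have := double_sum_almost_invariant (F n) A eps (fun z => (z \in S)%:R) (ind01 S) invA.
rewrite ler_norml => /andP[lo _].
have hi : \sum_(h <- F n) \sum_(x <- A) ((x * h)%g \in S)%:R <=
    (m + a * (2 * eps * a * a)) * #|` F n|%:R.
  apply: (@le_trans _ _ (\sum_(h <- F n) (m + a * \sum_(x <- A) \sum_(y <- A) q x y h))).
    by apply: ler_sum => h _; exact: pointwise.
  rewrite big_split /= sum_const_fset -mulr_sumr mulrDl lerD2l -mulrA ler_pM2l //.
  rewrite exchange_big /=.
  apply: (@le_trans _ _ (\sum_(x <- A) \sum_(y <- A) 2 * eps * #|` F n|%:R)).
    rewrite big_seq [leRHS]big_seq; apply: ler_sum => x xA.
    rewrite exchange_big /= big_seq [leRHS]big_seq; apply: ler_sum => y yA.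
    exact: sum_q.
  by rewrite !sum_const_fset -/a; lra.
have freqn' : (d - eps) * #|` F n|%:R <= \sum_(x <- F n) (x \in S)%:R.
  by move: freqn; rewrite rel_freqE ltr_pdivlMr // => /ltW.
have : (d * a - m) * #|` F n|%:R <= 2 * eps * a * (1 + a * a) * #|` F n|%:R.
  move: freqn'; rewrite -(ler_pM2l a0) => freqn'; move: lo hi; rewrite -/a; lra.
rewrite ler_pM2r //.
have -> : 2 * eps * a * (1 + a * a) = (d * a - m) / 2.
  by rewrite /eps; field; have := mulr_gt0 a0 a0; lra.
by move: ltB; lra.
Unshelve. all: by end_near. Qed.

(** Handling the indices one after the other, each inside the clique found for
the previous ones, makes the densities multiply. *)
Lemma bigcap_Delta2_clique_dense (I : eqType) (s : seq I) (F : I -> nat -> {fset G})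
    (S : I -> set G) (A : {fset G}) :
  (forall i, left_folner R (F i)) -> (forall i, 0 < upper_density R (F i) (S i)) ->
  exists B : {fset G}, [/\ B `<=` A,
    clique (\bigcap_(i in [set` s]) Delta2 R (F i) (S i))%classic [set` B] &
    \prod_(i <- s) upper_density R (F i) (S i) * #|` A|%:R <= #|` B|%:R]%fset.
Proof.
move=> folF posS; elim: s A => [|i s IHs] A.
  by exists A; split=> //; rewrite big_nil mul1r.
have [B [BA cB dB]] := Delta2_clique_dense (F i) (S i) A (folF i).
have [B' [B'B cB' dB']] := IHs B.
exists B'; split; first exact: fsubset_trans BA.
- move=> x y xB yB j /=; rewrite inE => /orP[/eqP->|js]; last exact: (cB' x y).
  by apply: cB; exact: (fsubsetP B'B).
- rewrite big_cons mulrAC mulrC; apply: le_trans dB'.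
  rewrite ler_wpM2l // prodr_ge0 // => j _; exact: ltW.
Qed.

(** In a finite set M of largest size among those in which no two distinct a, b
have both a b^-1 and b a^-1 in D, a clique has at most one element, which bounds
the size of M.  Maximality yields the two memberships together, one for each of
the left and the right coverings. *)
Lemma clique_dense_syndetic (D : set G) (delta : R) :
  0 < delta ->
  (forall A : {fset G}, exists B : {fset G}, [/\ B `<=` A, clique D [set` B] &
    delta * #|` A|%:R <= #|` B|%:R]%fset) ->
  exists2 M : {fset G}, delta * #|` M|%:R <= 1 &
    forall g, exists2 a, a \in M & D (g * a^-1)%g /\ D (a * g^-1)%g.
Proof.
move=> delta0 dense.
pose sep (M : {fset G}) := forall a b, a \in M -> b \in M -> a != b ->
  ~ (D (a * b^-1)%g /\ D (b * a^-1)%g).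
have card_sep M : sep M -> delta * #|` M|%:R <= 1.
  move=> sepM; have [B [BM cB]] := dense M; move=> /le_trans; apply.
  have [->|[x xB]] := fset_0Vmem B; first by rewrite cardfs0 ler01.
  rewrite (cardfsD1 x) xB; have [->|[y]] := fset_0Vmem (B `\ x)%fset.
    by rewrite cardfs0 addn0.
  rewrite in_fsetD1 => /andP[yx yB]; exfalso.
  have inM := fsubsetP BM.
  by apply: (sepM y x (inM _ yB) (inM _ xB) yx); split; apply: cB.
have D1 : D 1%g.
  have [B [B1 cB dB]] := dense [fset 1%g]%fset.
  have /fset0Pn[x xB] : B != fset0.
    by apply/eqP => B0; move: dB; rewrite B0 cardfs0 cardfs1; lra.
  by have := cB x x xB xB; rewrite mulgV.
have [M sepM maxM] : exists2 M, sep M & forall M', sep M' -> (#|` M'| <= #|` M|)%N.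
  apply: (ex_max_fset sep (Num.truncn delta^-1)) => [|M /card_sep].
    by exists fset0 => a b; rewrite in_fset0.
  move=> card_le; rewrite truncn_ge_nat; last by rewrite invr_ge0 ltW.
  by rewrite -(ler_pM2l delta0) mulfV ?gt_eqF.
exists M => [|g]; first exact: card_sep.
have [gM|gM] := boolP (g \in M); first by exists g => //; rewrite mulgV.
apply: contrapT => nog.
have : sep (g |` M)%fset.
  move=> a b /fset1UP[->|aM] /fset1UP[->|bM] ab; try by rewrite eqxx in ab.
  - by move=> [D1' D2']; apply: nog; exists b.
  - by move=> [D1' D2']; apply: nog; exists a.
  - exact: sepM.
by move=> /maxM; rewrite cardfsU1 gM ltnn.
Qed.
End FiniteCliques.

(** * The theorem *)

Theorem theorem1p5 (R : realType) (G : groupType)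
    (countG : countable [set: G]) (infG : infinite_set [set: G])
    (amenG : amenable R G) (k : nat)
    (GG : nat -> {fset G}) (F : 'I_k -> nat -> {fset G})
    (folnerGG : left_folner R GG) (folnerF : forall i, left_folner R (F i))
    (temperedGG : left_tempered R GG)
    (S_ : 'I_k -> set G)
    (S_pos : forall i, 0 < upper_density R (F i) (S_ i)) :
  let D : set G := \bigcap_(i in [set: 'I_k]) Delta2 R (F i) (S_ i) in
  (exists S : set G,
     (exists d : R, has_density GG S d /\
        \prod_(i < k) upper_density R (F i) (S_ i) <= d) /\
     Delta1 S `<=` D) /\
  (exists (l : nat) (m : 'I_l -> G),
     [/\ l%:R <= \prod_(i < k) (1 / upper_density R (F i) (S_ i)),
         \bigcup_(i in [set: 'I_l]) [set (m i * x)%g | x in D] = [set: G] &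
         \bigcup_(i in [set: 'I_l]) [set (x * (m i)^-1)%g | x in D]
           = [set: G]]).
Proof.
move=> D.
have -> : \prod_(i < k) (1 / upper_density R (F i) (S_ i)) =
    (\prod_(i < k) upper_density R (F i) (S_ i))^-1.
  by rewrite -prodfV; apply: eq_bigr => i _; rewrite div1r.
set delta : R := \prod_(i < k) _.
have delta0 : 0 < delta by apply: prodr_gt0.
have dense A : exists B : {fset G}, [/\ (B `<=` A)%fset, clique D [set` B] &
    delta * #|` A|%:R <= #|` B|%:R].
  have [B [BA cB dB]] :=
    bigcap_Delta2_clique_dense _ (index_enum 'I_k) F S_ A folnerF S_pos.
  exists B; split=> // x y xB yB i _; apply: cB => //=.
  exact: mem_index_enum.
split.
  have [K|d [le_d lower_d upper_d]] := extremal_density (R := R) D delta.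
    have [B [/fsubsetP BK cB dB]] := dense K; exists [set` B] => //.
    apply: (le_trans dB); rewrite /count_in -card_sum_fset ler_nat.
    apply/fsubset_leq_card/fsubsetP => x xB.
    by rewrite in_fset_sep BK //= mem_set.
  have [S cS densS] := clique_of_exact_density D GG d folnerGG temperedGG lower_d upper_d.
  exists S; split; first by exists d; split=> //; have [] := cvg_limn_inf_sup densS.
  move=> g [h [Sh]] /=; rewrite /inv_translate /= => Sgh.
  by have := cS _ _ Sgh Sh; rewrite mulgK.
have [M cardM covM] := clique_dense_syndetic D delta delta0 dense.
exists #|` M|, (fun i : 'I_#|` M| => (nth 1%g M i)^-1%g).
have index a : a \in M -> exists i : 'I_#|` M|, nth 1%g M i = a.
  move=> aM; have iM : (index a M < #|` M|)%N by rewrite index_mem.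
  by exists (Ordinal iM); rewrite /= nth_index.
split.
- by rewrite -(ler_pM2l delta0) mulfV ?gt_eqF.
(* For the left covering the covering element is sought for the inverse of g. *)
- apply/seteqP; split=> // g _; have [a /index[i <-] [_ Da]] := covM g^-1%g.
  exists i => //; exists (nth 1%g M i * g)%g; last exact: mulKg.
  by move: Da; rewrite invgK.
- apply/seteqP; split=> // g _; have [a /index[i <-] [Da _]] := covM g.
  exists i => //; exists (g * (nth 1%g M i)^-1)%g => //.
  by rewrite invgK mulgVK.
Qed.
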